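(* Let $a\in\mathbb{D}$, let ${\rm B}(z)=z\varphi_a(z)$, and let $\lambda$ be a positive even integer. On $\mathbb{A}^{(\lambda)}(\mathbb{D})$ one has $M_{\rm B}\mathbb{P}_1=\mathbb{P}_1M_{\rm B}$. Therefore, $\mathcal{M}_1$ and $\mathcal{M}_{-1}$ are reducing subspaces of $M_{\rm B}$ on $\mathbb{A}^{(\lambda)}(\mathbb{D})$ for every positive even integer $\lambda$.
   Context: $\mathbb{D}$ is the open unit disc. For $a\in\mathbb{D}$ and $|t|=1$, $\varphi_{t,a}(z)=t\frac{z-a}{1-\bar az}$ and $\varphi_a=\varphi_{1,a}$; $\varphi_{-1,a}$ is an involution of $\mathbb{D}$. For $\lambda>0$, $\mathbb{A}^{(\lambda)}(\mathbb{D})$ is the Hilbert space of holomorphic functions on $\mathbb{D}$ with reproducing kernel $(1-z\bar w)^{-\lambda}$. For a positive even integer $\lambda$ and a biholomorphic automorphism $\varphi$ of $\mathbb{D}$, define $U^{(\lambda)}(\varphi^{-1})f=(\varphi')^{\lambda/2}\cdot(f\circ\varphi)$; this is a unitary representation of the automorphism group of $\mathbb{D}$ on $\mathbb{A}^{(\lambda)}(\mathbb{D})$. Put $\mathbb{P}_1=\tfrac12\big(I+U^{(\lambda)}(\varphi_{-1,a})\big)$. $\mathcal{M}_1$ and $\mathcal{M}_{-1}$ are the eigenspaces of the self-adjoint unitary $U^{(\lambda)}(\varphi_{-1,a})$ for the eigenvalues $1$ and $-1$ respectively. $M_{\rm B}$ is the operator of multiplication by ${\rm B}$. A reducing subspace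 of an operator $T$ is a closed subspace invariant under $T$ and $T^*$. *)

(* Defs.v *)
From HB Require Import structures.
From mathcomp Require Import all_boot all_order all_algebra complex.
From mathcomp Require Import all_classical all_reals all_analysis.
From mathcomp Require Import ring.

Set Implicit Arguments.
Unset Strict Implicit.
Unset Printing Implicit Defensive.

Import Order.TTheory GRing.Theory Num.Theory.
Import numFieldNormedType.Exports.

Local Open Scope classical_set_scope.
Local Open Scope ring_scope.

Section Disc.
Variable R : realType.
Local Notation C := R[i].

Definition disc : set C := [set z | `|z| < 1].

(* The field of scalars is C itself, so derivability in the direction 1 is
   complex differentiability. *)
Definition holomorphic (f : C -> C) : Prop :=
  forall z, disc z -> derivable (f : C^o -> C^o) z 1.

Definition eq_disc (f g : C -> C) : Prop := forall z, disc z -> f z = g z.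

(* Biholomorphic automorphisms of the disc; only the values on the disc are
   meaningful. *)
Record disc_aut := DiscAut {
  aut_fun :> C -> C;
  aut_inv : C -> C;
  aut_fun_disc : forall z, disc z -> disc (aut_fun z);
  aut_inv_disc : forall z, disc z -> disc (aut_inv z);
  aut_funK : forall z, disc z -> aut_inv (aut_fun z) = z;
  aut_invK : forall z, disc z -> aut_fun (aut_inv z) = z;
  aut_fun_holo : holomorphic aut_fun;
  aut_inv_holo : holomorphic aut_inv }.

Definition inv_aut (phi : disc_aut) : disc_aut :=
  DiscAut (@aut_inv_disc phi) (@aut_fun_disc phi) (@aut_invK phi)
          (@aut_funK phi) (@aut_inv_holo phi) (@aut_fun_holo phi).

Definition mobius (t a z : C) : C := t * ((z - a) / (1 - a^* * z)).

Lemma mobius_den (a z : C) : `|a| < 1 -> disc z -> 1 - a^* * z != 0.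
Proof.
move=> ha hz; apply/eqP => /eqP; rewrite subr_eq0 => /eqP h.
have : `|a^* * z| < 1.
  by rewrite normrM norm_conjC mulr_ilt1.
by rewrite -h normr1 ltxx.
Qed.

Lemma mobius_disc (t a z : C) :
  `|t| = 1 -> `|a| < 1 -> disc z -> disc (mobius t a z).
Proof.
move=> ht ha hz; have hd := mobius_den ha hz.
rewrite /disc /mobius /= normrM ht mul1r normrM normfV.
rewrite ltr_pdivrMr ?normr_gt0// mul1r -(@ltr_pXn2r _ 2) ?nnegrE//.
rewrite !normCK !rmorphB !rmorphM/= rmorph1 conjCK -subr_gt0.
have -> : (1 - a^* * z) * (1 - a * z^*) - (z - a) * (z^* - a^*) =
          (1 - a * a^*) * (1 - z * z^*).
  by rewrite !mulrBl !mulrBr; ring.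
by rewrite mulr_gt0// subr_gt0 -normCK expr_lt1.
Qed.

Lemma mobius_param (t a : C) :
  `|t| = 1 -> `|a| < 1 -> `|t^*| = 1 /\ `|- (t * a)| < 1.
Proof. by move=> ht ha; rewrite norm_conjC normrN normrM ht mul1r. Qed.

Lemma mobiusK (t a z : C) : `|t| = 1 -> `|a| < 1 -> disc z ->
  mobius t^* (- (t * a)) (mobius t a z) = z.
Proof.
move=> ht ha hz; have hd := mobius_den ha hz.
have tt : t * t^* = 1 by rewrite -normCK ht expr1n.
have tt' : t^* * t = 1 by rewrite mulrC.
have ha' : 1 - a * a^* != 0.
  by rewrite -normCK subr_eq0 eq_sym lt_eqF// expr_lt1.
rewrite /mobius rmorphN rmorphM/=.
have -> : t * ((z - a) / (1 - a^* * z)) - - (t * a) =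
          t * (z * (1 - a * a^*) / (1 - a^* * z)) by field.
have -> : 1 - - (t^* * a^*) * (t * ((z - a) / (1 - a^* * z))) =
          (1 - a * a^*) / (1 - a^* * z).
  have -> : - (t^* * a^*) * (t * ((z - a) / (1 - a^* * z))) =
     - ((t^* * t) * (a^* * ((z - a) / (1 - a^* * z)))) by ring.
  by rewrite tt'; field.
rewrite mulrA mulrA tt' mul1r; field.
by rewrite hd ha'.
Qed.

Lemma mobius_holo (t a : C) : `|a| < 1 -> holomorphic (mobius t a).
Proof.
move=> ha z hz; have hd := mobius_den ha hz.
rewrite /mobius.
apply: derivableM; first exact: derivable_cst.
apply: derivableM; first exact: derivableB.
apply: derivableV => //; apply: derivableB => //.
Qed.

Lemma mobius_invK (t a z : C) : `|t| = 1 -> `|a| < 1 -> disc z ->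
  mobius t a (mobius t^* (- (t * a)) z) = z.
Proof.
move=> ht ha hz; have [ht' ha'] := mobius_param ht ha.
have := mobiusK ht' ha' hz.
by rewrite conjCK mulrN mulrA (mulrC _ t) -normCK ht expr1n mul1r opprK.
Qed.

Definition mobius_aut (t a : C) (ht : `|t| = 1) (ha : `|a| < 1) : disc_aut :=
  let p := mobius_param ht ha in
  @DiscAut (mobius t a) (mobius t^* (- (t * a)))
    (fun z => @mobius_disc t a z ht ha)
    (fun z => @mobius_disc _ _ z p.1 p.2)
    (fun z => @mobiusK t a z ht ha)
    (fun z => @mobius_invK t a z ht ha)
    (@mobius_holo t a ha)
    (@mobius_holo _ _ p.2).

(* A Hilbert space of holomorphic functions on the disc with reproducing
   kernel K.  Its elements are abstract vectors f; ev f is the function that f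
   is, which matters on the disc only.  The inner product is linear in its
   first argument. *)
Record rkhs (K : C -> C -> C) := RKHS {
  rkhs_car :> completeNormedModType C;
  ip : {dot rkhs_car for @Num.conj C};
  ip_norm : forall f : rkhs_car, ip f f = `|f| ^+ 2;
  ev : rkhs_car -> C -> C;
  ev_linear : forall (c : C) (f g : rkhs_car),
    eq_disc (ev (c *: f + g)) (fun z => c * ev f z + ev g z);
  ev_inj : forall f g : rkhs_car, eq_disc (ev f) (ev g) -> f = g;
  ev_holo : forall f : rkhs_car, holomorphic (ev f);
  ev_kernel : forall w, disc w -> exists2 k : rkhs_car,
    eq_disc (ev k) (K ^~ w) & forall f : rkhs_car, ev f w = ip f k }.

Definition szego_power (lam : nat) (z w : C) : C := (1 - z * w^*) ^- lam.

Definition Aspace (lam : nat) := rkhs (szego_power lam).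

Section Operators.
Variables (K : C -> C -> C) (H : rkhs K).

(* T is the operator f |-> Phi f on H; in particular Phi maps H to H. *)
Definition acts_as (Phi : (C -> C) -> C -> C) (T : H -> H) : Prop :=
  forall f : H, eq_disc (ev (T f)) (Phi (ev f)).

(* The operator f |-> Phi f, with the value 0 at those f for which Phi f is
   not in H. *)
Definition operator_of (Phi : (C -> C) -> C -> C) (f : H) : H :=
  xget 0 [set g : H | eq_disc (ev g) (Phi (ev f))].

Definition mul_by (b : C -> C) (f : C -> C) (z : C) : C := b z * f z.

Definition mul_op (b : C -> C) : H -> H := operator_of (mul_by b).

Definition bounded_operator (T : H -> H) : Prop := linear T /\ continuous T.

Definition adjoint (T T' : H -> H) : Prop :=
  forall f g : H, ip H (T f) g = ip H f (T' g).

Definition closed_subspace (M : set H) : Prop :=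
  [/\ closed M, M 0 &
      forall (c : C) (f g : H), M f -> M g -> M (c *: f + g)].

Definition invariant (T : H -> H) (M : set H) : Prop :=
  forall f, M f -> M (T f).

Definition reducing (T : H -> H) (M : set H) : Prop :=
  [/\ closed_subspace M, invariant T M &
      exists2 T' : H -> H, adjoint T T' & invariant T' M].

Definition op_eigenspace (T : H -> H) (c : C) : set H := [set f | T f = c *: f].

End Operators.

Definition rep_inv_act (lam : nat) (phi : disc_aut) (f : C -> C) (z : C) : C :=
  derive1 (phi : C^o -> C^o) z ^+ lam./2 * f (phi z).

(* rep_inv_act lam phi is the action of phi^-1; the action of psi is obtained
   by taking phi = psi^-1. *)
Definition rep_act (lam : nat) (psi : disc_aut) : (C -> C) -> C -> C :=
  rep_inv_act lam (inv_aut psi).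

Definition rep (lam : nat) (H : Aspace lam) (psi : disc_aut) : H -> H :=
  operator_of (rep_act lam psi).

Definition half_sum (V : lmodType C) (U : V -> V) (f : V) : V :=
  2^-1 *: (f + U f).

End Disc.

(* Main.v *)
Require Import Defs.
From HB Require Import structures.
From mathcomp Require Import all_boot all_order all_algebra complex.
From mathcomp Require Import all_classical all_reals all_analysis.
From mathcomp Require Import ring.
Set Implicit Arguments.
Unset Strict Implicit.
Unset Printing Implicit Defensive.
Import Order.TTheory GRing.Theory Num.Theory.
Import numFieldNormedType.Exports.
Local Open Scope classical_set_scope.
Local Open Scope ring_scope.

(** Write phi for the involution, m = lam / 2, and (U f)(z) = phi'(z)^m f(phi z).
    The algebraic heart is that B = z phi_a = - z phi is invariant under phi,
    because phi exchanges the two factors z and phi z; as U f is a multiple of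
    f o phi, it follows that U M_B = M_B U, which gives the commutation with the
    projection (I + U) / 2.

    That U and M_B are bounded operators on the space requires knowing which
    functions belong to an abstract reproducing kernel Hilbert space.  The tool
    is [wcomp_contracts]: the operator f |-> g (f o psi) is a contraction of the
    space of kernel K as soon as
    K(z, w) - g(z) conj(g(w)) K(psi z, psi w) is positive semidefinite.  It rests
    on a Riesz representation theorem, [riesz_linear_relation], proved by
    minimising an energy.  For U the difference of kernels vanishes
    ([szego_power_mobius]); for multiplication by z it is the kernel
    (1 - z conj w)^(1 - lam), positive by [psd_szego_power].  Finally
    M_B = - M_z U M_z U, because U^2 = I and conjugation by U turns M_z into
    multiplication by phi.

    The contractive involution U is self-adjoint, so the adjoint of M_B, which
    exists by the Riesz theorem again, commutes with U too.  Hence the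
    eigenspaces of U, closed by continuity, are reducing
    ([commuting_eigenspace_reducing]). *)

(** * Riesz representation of a linear relation in a Hilbert space *)

Section Hilbert.
Variable R : realType.
Local Notation C := R[i].

(** The discriminant inequality for a real quadratic polynomial in a complex
    unknown [t].  It yields the Cauchy-Schwarz inequality and, with [A] the
    defect of an almost minimiser, the first-order condition in the Riesz
    argument below. *)
Lemma normsq_le_of_quadratic_ge0 (A d N : C) : 0 <= A -> 0 <= N ->
  (forall t, 0 <= A + (t * d + (t * d)^*) + `|t| ^+ 2 * N) ->
  `|d| ^+ 2 <= A * N.
Proof.
move=> A0 N0 pos; have [->|d0] := eqVneq d 0.
  by rewrite normr0 expr0n mulr_ge0.
have cA : (A + 1)^* = A + 1 by rewrite (CrealP _)// rpredD// ger0_real.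
have [N00|Nneq0] := eqVneq N 0.
  (* This [t] makes the linear part equal to -2 (A + 1). *)
  have := pos (- (A + 1) / d).
  rewrite N00 mulr0 addr0 divfK// rmorphN /= cA => pos'.
  have : A + 2 <= 0.
    by move: pos'; rewrite -oppr_le0; congr (_ <= _); ring.
  have A2 : 0 < A + 2 by rewrite ltr_wpDl.
  by move=> /(lt_le_trans A2); rewrite ltxx.
have cN : N^* = N by rewrite (CrealP _)// ger0_real.
(* The minimum of the quadratic polynomial is attained here. *)
have := pos (- (d^* / N)).
rewrite normrN normrM normfV (ger0_norm N0) norm_conjC.
rewrite rmorphM rmorphN rmorphM fmorphV /= conjCK cN.
have -> : A + (- (d^* / N) * d + - (d / N) * d^*) + (`|d| / N) ^+ 2 * N
        = A - `|d| ^+ 2 / N.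
  rewrite (_ : - (d^* / N) * d = - (`|d| ^+ 2 / N)); last by rewrite normCK; ring.
  rewrite (_ : - (d / N) * d^* = - (`|d| ^+ 2 / N)); last by rewrite normCK; ring.
  by field.
by rewrite subr_ge0 ler_pdivrMr// lt_def Nneq0.
Qed.

Variables (V : completeNormedModType C) (dot : {dot V for @Num.conj C}).
Hypothesis dot_norm : forall f : V, dot f f = `|f| ^+ 2.
Local Notation "''[' u , v ]" := (dot u v).

Lemma dotC u v : '[u, v] = '[v, u]^*.
Proof. by rewrite hermC expr0 mul1r. Qed.

Lemma normsq_addZ (t : C) (u v : V) :
  `|t *: u + v| ^+ 2
  = `|v| ^+ 2 + (t * '[u, v] + (t * '[u, v])^*) + `|t| ^+ 2 * `|u| ^+ 2.
Proof.
rewrite -!dot_norm linearDl/= !linearDr/= linearZl_LR/= !linearZr_LR/=.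
rewrite linearZl_LR/= (dotC v u) rmorphM/= normCK.
rewrite -[_ *: (t * _)]/(_ * (t * _)).
ring.
Qed.

Lemma norm_dot_le u v : `|'[u, v]| <= `|u| * `|v|.
Proof.
rewrite -(@ler_pXn2r _ 2) ?nnegrE ?mulr_ge0// exprMn mulrC.
apply: normsq_le_of_quadratic_ge0; rewrite ?exprn_ge0// => t.
by rewrite -normsq_addZ exprn_ge0.
Qed.

(** The functional minimised in the Riesz representation theorem: if [l] is the
    value at [h] of the functional represented by [g], this is
    |h - g|^2 - |g|^2. *)
Definition riesz_energy (h : V) (l : C) : C := `|h| ^+ 2 - (l + l^*).

Lemma riesz_energyD (t : C) h h' l l' :
  riesz_energy (t *: h' + h) (t * l' + l) =
  riesz_energy h l + (t * ('[h', h] - l') + (t * ('[h', h] - l'))^*)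
  + `|t| ^+ 2 * `|h'| ^+ 2.
Proof.
rewrite /riesz_energy normsq_addZ !(rmorphD, rmorphM, rmorphN)/=.
ring.
Qed.

Lemma riesz_energy_real h l : riesz_energy h l \is Num.real.
Proof.
rewrite /riesz_energy rpredB// ?rpredX ?normr_real//.
by apply/CrealP; rewrite rmorphD/= conjCK addrC.
Qed.

(** A pair whose energy is within [delta ^+ 2] of the lower bound [m] satisfies
    the Euler equation up to [delta]: perturbing it by [t] times any other pair
    of [G] keeps the energy above [m], which is a nonnegative quadratic
    polynomial in [t]. *)
Lemma riesz_near_minimizer (G : V -> C -> Prop) (m delta : C) h l :
  (forall c h h' l l', G h l -> G h' l' -> G (c *: h + h') (c * l + l')) ->
  (forall h l, G h l -> m <= riesz_energy h l) ->
  0 <= delta -> G h l -> riesz_energy h l <= m + delta ^+ 2 ->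
  forall h' l', G h' l' -> `|'[h', h] - l'| <= delta * `|h'|.
Proof.
move=> Glin Gm d0 Ghl El h' l' Ghl'.
rewrite -(@ler_pXn2r _ 2) ?nnegrE ?mulr_ge0// exprMn.
apply: normsq_le_of_quadratic_ge0; rewrite ?exprn_ge0// => t.
rewrite -(lerD2l m) addr0; apply: le_trans (Gm _ _ (Glin t _ _ _ _ Ghl' Ghl)) _.
by rewrite riesz_energyD !addrA !lerD2r.
Qed.

(** Riesz representation for a bounded functional given by its graph, a linear
    relation [G].  A functional prescribed on combinations of kernel vectors is
    of this kind, and the bound makes its single-valuedness automatic.  The
    almost minimisers of the energy form a Cauchy filter, and the approximate
    Euler equations pass to its limit. *)
Theorem riesz_linear_relation (G : V -> C -> Prop) (c : C) :
  (exists h l, G h l) ->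
  (forall c h h' l l', G h l -> G h' l' -> G (c *: h + h') (c * l + l')) ->
  0 <= c -> (forall h l, G h l -> `|l| <= c * `|h|) ->
  exists2 g : V, `|g| <= c & forall h l, G h l -> l = '[h, g].
Proof.
move=> [h0 [l0 Ghl0]] Glin c0 Gc.
(* Completing the square bounds the energy below by - c ^+ 2. *)
have Ebelow h l : G h l -> - c ^+ 2 <= riesz_energy h l.
  move=> /Gc lh; rewrite -subr_ge0 opprK /riesz_energy.
  have l2 : l + l^* <= c * `|h| *+ 2.
    apply: le_trans (_ : `|l + l^*| <= _).
      by apply: real_ler_norm; apply/CrealP; rewrite rmorphD/= conjCK addrC.
    by rewrite (le_trans (ler_normD _ _))// norm_conjC mulr2n lerD.
  apply: le_trans (_ : (`|h| - c) ^+ 2 <= _).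
    by rewrite real_exprn_even_ge0// rpredB ?normr_real// ger0_real.
  rewrite -subr_ge0; move: l2; rewrite -subr_ge0; congr (_ <= _).
  by rewrite -mulr_natr; ring.
pose S : set R := [set complex.Re (riesz_energy p.1 p.2) | p in [set p | G p.1 p.2]].
have toC h l : (complex.Re (riesz_energy h l))%:C%C = riesz_energy h l.
  by apply: RRe_real; exact: riesz_energy_real.
have Slb : lbound S (- complex.Re (c ^+ 2)).
  move=> _ [[h l] /= Ghl <-]; rewrite -lecR toC rmorphN/=.
  by rewrite RRe_real ?rpredX ?ger0_real//; exact: Ebelow.
have Sinf : has_inf S.
  split; last by exists (- complex.Re (c ^+ 2)).
  by exists (complex.Re (riesz_energy h0 l0)); exists (h0, l0).
pose m := inf S.
have Gm h l : G h l -> m%:C%C <= riesz_energy h l.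
  move=> Ghl; rewrite -toC lecR; apply: ge_inf; first by case: Sinf.
  by exists (h, l).
pose A (d : R) : set V :=
  [set h | exists2 l, G h l & riesz_energy h l <= m%:C%C + d%:C%C ^+ 2].
have A0 d : 0 < d -> A d !=set0.
  move=> d0; have [_ [[h l] /= Ghl <-]] := inf_adherent (exprn_gt0 2 d0) Sinf.
  rewrite -ltcR toC rmorphD rmorphXn/= => /ltW Elt.
  by exists h, l.
have AP d h h' l' : 0 < d -> A d h -> G h' l' ->
    `|'[h', h] - l'| <= d%:C%C * `|h'|.
  move=> d0 [l Ghl El] Ghl'.
  by apply: riesz_near_minimizer Glin Gm _ Ghl El _ _ Ghl'; rewrite ler0c ltW.
have Adist d h h' : 0 < d -> A d h -> A d h' -> `|h - h'| <= (d *+ 2)%:C%C.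
  move=> d0 Ah Ah'.
  have [[l Ghl _] [l' Ghl' _]] := (Ah, Ah').
  have Gd : G (h - h') (l - l').
    by have := Glin (-1) _ _ _ _ Ghl' Ghl; rewrite scaleN1r mulN1r !(addrC (- _)).
  have [->|hh'] := eqVneq (h - h') 0; first by rewrite normr0 ler0c mulrn_wge0// ltW.
  have hh'0 : 0 < `|h - h'| by rewrite normr_gt0.
  (* The Euler defects of h and h' along h - h' differ by the squared
     distance. *)
  have E : `|h - h'| ^+ 2 =
      ('[h - h', h] - (l - l')) - ('[h - h', h'] - (l - l')).
    by rewrite -dot_norm [LHS]linearBr/=; ring.
  rewrite -(ler_pM2r hh'0) -expr2.
  rewrite -[X in X <= _]ger0_norm ?exprn_ge0// E.
  apply: le_trans (ler_normB _ _) _.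
  by rewrite rmorphMn/= mulr2n mulrDl; apply: lerD; apply: AP.
pose F := filter_from [set d : R | 0 < d] A.
have Asub d d' : d <= d' -> 0 < d -> A d `<=` A d'.
  move=> dd' d0 h [l Ghl El]; exists l => //; apply: le_trans El _.
  rewrite lerD2l -!rmorphXn/= lecR ler_pXn2r// ?nnegrE ltW//.
  exact: lt_le_trans dd'.
have FF : ProperFilter F.
  apply: filter_from_proper; last by move=> d; exact: A0.
  apply: filter_from_filter; first by exists 1 => /=.
  move=> d d' /= d0 d'0; exists (Num.min d d') => /=.
    by rewrite lt_min d0.
  by move=> h Ah; split; apply: Asub Ah; rewrite ?lt_min ?d0// ge_min lexx ?orbT.
have F_cvg : cvg F.
  apply: cauchy_cvg; apply/cauchy_exP => e e0.
  have [e' e'E] : exists k, e = k%:C%C by apply/complex_realP; exact: gtr0_real.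
  have e'0 : 0 < e' by rewrite -ltcR -e'E.
  have e3 : 0 < e' / 3 by rewrite divr_gt0.
  have [h Ah] := A0 _ e3; exists h.
  exists (e' / 3) => // h' Ah'; rewrite -ball_normE /=.
  apply: le_lt_trans (Adist _ _ _ e3 Ah Ah') _.
  rewrite e'E ltcR -[_ *+ 2]mulr_natr -mulrA gtr_pMr// mulrC ltr_pdivrMr// mul1r.
  by rewrite ltr_nat.
pose g := lim F.
have near_g (e : C) : 0 < e -> exists h, [/\ `|g - h| <= e, exists l, G h l &
    forall h' l', G h' l' -> `|'[h', h] - l'| <= e * `|h'|].
  move=> e0.
  have [e' e'E] : exists k, e = k%:C%C by apply/complex_realP; exact: gtr0_real.
  have e'0 : 0 < e' by rewrite -ltcR -e'E.
  have [d /= d0 Ad] : F (ball g e) by apply: F_cvg; exact: nbhsx_ballx.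
  have d'0 : 0 < Num.min d e' by rewrite lt_min d0.
  have [h Ah] := A0 _ d'0; exists h; split.
  - have : ball g e h by apply: Ad; apply: Asub Ah => //; rewrite ge_min lexx.
    by rewrite -ball_normE /= => /ltW.
  - by have [l Ghl _] := Ah; exists l.
  - move=> h' l'; rewrite e'E; apply: AP => //.
    by apply: Asub Ah => //; rewrite ge_min lexx orbT.
have gE h l : G h l -> l = '[h, g].
  move=> Ghl; apply/eqP; rewrite eq_sym -subr_eq0 -normr_le0.
  apply/ler_addgt0Pr => e e0; rewrite add0r.
  (* The error is at most |h| times twice the tolerance given to near_g. *)
  have k0 : 0 < `|h| *+ 2 + 1 by rewrite ltr_wpDl// mulrn_wge0.
  have [h' [gh' _ Gh']] := near_g _ (divr_gt0 e0 k0).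
  rewrite (_ : _ - l = '[h, g - h'] + ('[h, h'] - l)); last first.
    by rewrite linearBr/=; ring.
  apply: le_trans (ler_normD _ _) _.
  apply: le_trans (lerD (norm_dot_le _ _) (Gh' _ _ Ghl)) _.
  apply: le_trans (lerD (ler_wpM2l _ gh') (lexx _)) _ => //.
  rewrite (mulrC `|h|) -mulrDr -mulrA (ler_piMr (ltW e0))//.
  by rewrite mulrC ler_pdivrMr// mul1r -mulr2n ltW// ltrDl.
exists g => //.
(* |g|^2 is close to <h, g> = l, which is at most c |h|, close to c |g|. *)
apply/ler_addgt0Pr => e e0.
have [->|g0] := eqVneq g 0; first by rewrite normr0 addr_ge0// ltW.
have {}g0 : 0 < `|g| by rewrite normr_gt0.
have k0 : 0 < c + `|g| by rewrite ltr_wpDl.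
have e'0 : 0 < e * `|g| / (c + `|g|) by rewrite divr_gt0// mulr_gt0.
have [h [gh [l Ghl] _]] := near_g _ e'0.
rewrite -(ler_pM2r g0) -expr2 -dot_norm -[X in '[X, g]](subrK h) linearDl/=.
apply: le_trans (_ : `|_| <= _).
  apply: real_ler_norm; rewrite -linearDl/= subrK dot_norm.
  by rewrite rpredX// normr_real.
apply: le_trans (ler_normD _ _) _.
rewrite -(gE _ _ Ghl).
have hg : `|h| <= `|g| + `|g - h|.
  by rewrite -[X in `|X| <= _](subKr g); exact: ler_normB.
apply: le_trans (lerD (norm_dot_le _ _) (Gc _ _ Ghl)) _.
apply: le_trans (lerD (lexx _) (ler_wpM2l c0 hg)) _.
rewrite mulrDr addrCA (mulrC `|g - h|) -mulrDl (addrC `|g|) [X in _ <= X]mulrDl lerD2l.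
apply: le_trans (ler_wpM2l (ltW k0) gh) _.
by rewrite mulrC divfK// gt_eqF.
Qed.
End Hilbert.

(** * Positive semidefinite kernels on the disc *)

Section Kernels.
Variable R : realType.
Local Notation C := R[i].

Definition in_disc (s : seq (C * C)) := forall p, p \in s -> disc p.2.

Lemma in_disc_cons p s : in_disc (p :: s) -> disc p.2 /\ in_disc s.
Proof.
move=> ds; split; first by apply: ds; rewrite mem_head.
by move=> q qs; apply: ds; rewrite in_cons qs orbT.
Qed.

Lemma in_disc_map (u : C * C -> C) (v : C -> C) s :
  (forall z, disc z -> disc (v z)) -> in_disc s ->
  in_disc [seq (u p, v p.2) | p <- s].
Proof. by move=> dv ds _ /mapP[p /ds dp ->]; exact: dv. Qed.

(** The entries of [s] are pairs (coefficient, point); the arguments of [K] are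
    ordered so that this is the squared norm of the corresponding combination
    of kernel vectors. *)
Definition quad (K : C -> C -> C) (s : seq (C * C)) : C :=
  \sum_(p <- s) \sum_(q <- s) p.1 * q.1^* * K q.2 p.2.

Definition psd (K : C -> C -> C) := forall s, in_disc s -> 0 <= quad K s.

Lemma eq_quad K K' s : in_disc s ->
  (forall z w, disc z -> disc w -> K z w = K' z w) -> quad K s = quad K' s.
Proof.
move=> ds e; rewrite /quad big_seq [RHS]big_seq; apply: eq_bigr => p /ds dp.
by rewrite big_seq [RHS]big_seq; apply: eq_bigr => q /ds dq; rewrite e.
Qed.

Lemma quadB K K' s :
  quad (fun z w => K z w - K' z w) s = quad K s - quad K' s.
Proof.
rewrite /quad -sumrB; apply: eq_bigr => p _.
by rewrite -sumrB; apply: eq_bigr => q _; rewrite mulrBr.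
Qed.

(** The adjoint of the weighted composition operator f |-> g (f o psi) sends the
    kernel vector at w to conj (g w) times the kernel vector at psi w; [push] is
    this adjoint on formal combinations of kernel vectors. *)
Definition push (g psi : C -> C) (s : seq (C * C)) :=
  [seq (p.1 * (g p.2)^*, psi p.2) | p <- s].

Lemma quad_push K g psi s :
  quad K (push g psi s) =
  quad (fun z w => g z * (g w)^* * K (psi z) (psi w)) s.
Proof.
rewrite /quad big_map; apply: eq_bigr => p _.
rewrite big_map; apply: eq_bigr => q _ /=.
by rewrite rmorphM/= conjCK; ring.
Qed.

(** The order of the complex field is partial, so the reality of [x] has to be
    extracted as well: it comes from the reality of [x - y]. *)
Lemma ge0_of_approx (x : C) :
  (forall e, 0 < e -> exists2 y, `|y| <= e & y <= x) -> 0 <= x.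
Proof.
move=> approx; rewrite ger0_def -subr_eq0 -normr_le0; apply/ler_addgt0Pr => e e0.
have [y ye yx] := approx _ (divr_gt0 e0 (ltr0Sn _ 1)).
have -> : `|x| - x = (`|x| - `|x - y|) + (- y).
  by rewrite [`|x - y|]ger0_norm ?subr_ge0//; ring.
apply: le_trans (ler_normD _ _) _; rewrite add0r normrN (splitr e).
apply: lerD => //; apply: le_trans ye.
by apply: le_trans (ler_dist_dist _ _) _; rewrite opprB addrC subrK.
Qed.

(** A finite subset of the open disc stays away from the circle: this gives the
    geometric decay used for the positivity of the kernels. *)
Lemma in_disc_radius s : in_disc s ->
  exists2 r : R, 0 <= r < 1 & forall p, p \in s -> `|p.2| <= r%:C%C.
Proof.
elim: s => [_|p s IH /in_disc_cons[dp /IH[r /andP[r0 r1] rs]]].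
  by exists 0; rewrite ?lexx ?ltr01.
have [k kE] : exists k, `|p.2| = k%:C%C by apply/complex_realP; exact: normr_real.
have k1 : k < 1 by rewrite -ltcR -kE.
exists (Num.max r k); first by rewrite le_max r0 gt_max r1 k1.
move=> q; rewrite in_cons => /orP[/eqP->|/rs qr].
  by rewrite kE lecR le_max lexx orbT.
by apply: le_trans qr _; rewrite lecR le_max lexx.
Qed.

Lemma small_expr (r : R) (M e : C) : 0 <= r < 1 -> 0 <= M -> 0 < e ->
  exists n, M * r%:C%C ^+ n <= e.
Proof.
move=> /andP[r0 r1] M0 e0.
have [M' M'E] : exists k, M = k%:C%C by apply/complex_realP; exact: ger0_real.
have [e' e'E] : exists k, e = k%:C%C by apply/complex_realP; exact: gtr0_real.
have e'0 : 0 < e' by rewrite -ltcR -e'E.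
have : geometric M' r @ \oo --> 0 by apply: cvg_geometric; rewrite ger0_norm.
move=> /cvgrPdist_le/(_ _ e'0)[n _ /(_ n (leqnn n))].
rewrite /= sub0r normrN => ?; exists n.
rewrite M'E e'E -rmorphXn/= -rmorphM lecR; apply: le_trans (ler_norm _) _.
by [].
Qed.

(** [push id id] multiplies each coefficient by the conjugate of its point,
    so its iterates decay geometrically. *)
Lemma quad_push_id_small K s (e : C) : in_disc s -> 0 < e ->
  exists n, `|quad K (iter n (push id id) s)| <= e.
Proof.
move=> ds e0; have [r r01 rs] := in_disc_radius ds.
pose M := \sum_(p <- s) \sum_(q <- s) `|p.1 * q.1^* * K q.2 p.2|.
have M0 : 0 <= M by apply: sumr_ge0 => p _; apply: sumr_ge0.
have [n Mn] := small_expr r01 M0 e0; exists n; apply: le_trans Mn.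
have r0 : 0 <= r%:C%C :> C by rewrite ler0c; case/andP: r01.
have -> : iter n (push id id) s = [seq (p.1 * p.2^* ^+ n, p.2) | p <- s].
  elim: n => [|n IH] /=.
    by rewrite -[LHS]map_id; apply: eq_map => -[u v] /=; rewrite expr0 mulr1.
  rewrite IH /push -map_comp; apply: eq_map => p /=.
  by rewrite exprSr mulrA.
rewrite /quad big_map mulr_suml; apply: le_trans (ler_norm_sum _ _ _) _.
rewrite big_seq [X in _ <= X]big_seq; apply: ler_sum => p /rs pr.
rewrite big_map mulr_suml; apply: le_trans (ler_norm_sum _ _ _) _.
rewrite big_seq [X in _ <= X]big_seq; apply: ler_sum => q /rs qr /=.
have -> : p.1 * p.2^* ^+ n * (q.1 * q.2^* ^+ n)^* * K q.2 p.2 =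
    p.1 * q.1^* * K q.2 p.2 * (p.2^* ^+ n * q.2 ^+ n).
  by rewrite rmorphM rmorphXn/= conjCK; ring.
rewrite normrM ler_wpM2l// normrM !normrX norm_conjC.
rewrite -[X in _ <= X]mulr1; apply: ler_pM; rewrite ?exprn_ge0//.
  by rewrite lerXn2r.
rewrite exprn_ile1// (le_trans qr)// -[1](rmorph1 (real_complex R))/= lecR.
by case/andP: r01 => _ /ltW.
Qed.

Lemma one_sub_mul_conj_neq0 (z w : C) : disc z -> disc w -> 1 - z * w^* != 0.
Proof. by move=> dz dw; rewrite mulrC; exact: mobius_den. Qed.

Lemma szego_power_step m (z w : C) : disc z -> disc w ->
  szego_power m.+1 z w - z * w^* * szego_power m.+1 z w = szego_power m z w.
Proof.
move=> dz dw; have hzw := one_sub_mul_conj_neq0 dz dw.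
by rewrite /szego_power -[X in X - _]mul1r -mulrBl exprS invfM mulrA divff ?mul1r.
Qed.

(** Induction on [m].  The kernel of exponent m.+1 dominates its image under
    [push id id], the difference being the kernel of exponent m; iterating, it
    dominates forms that tend to 0.  This is the expansion
    1 / (1 - z conj w) = sum of (z conj w)^n, with the remainder kept exact. *)
Lemma psd_szego_power m : psd (@szego_power R m).
Proof.
elim: m => [|m IH] s ds.
  rewrite (_ : quad _ _ = `|\sum_(p <- s) p.1| ^+ 2) ?exprn_ge0//.
  rewrite normCK rmorph_sum/= mulr_suml /quad; apply: eq_bigr => p _.
  rewrite mulr_sumr; apply: eq_bigr => q _.
  by rewrite /szego_power expr0 invr1 mulr1.
have step n : quad (szego_power m.+1) (iter n (push id id) s) <=
              quad (szego_power m.+1) s.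
  elim: n s ds => //= n IHn s' ds'.
  have ds'n : in_disc (iter n (push id id) s').
    by elim: (n) => //= k; apply: in_disc_map.
  apply: le_trans (IHn _ ds'); rewrite -subr_ge0 quad_push -quadB.
  rewrite (@eq_quad _ (szego_power m)) ?IH// => z w dz dw.
  exact: szego_power_step.
apply: ge0_of_approx => e e0.
have [n ne] := quad_push_id_small (szego_power m.+1) ds e0.
by exists (quad (szego_power m.+1) (iter n (push id id) s)).
Qed.
End Kernels.

(** * Weighted composition operators on a reproducing kernel space *)

Section WeightedComposition.
Variables (R : realType) (K : R[i] -> R[i] -> R[i]) (H : rkhs K).
Local Notation C := R[i].
Local Notation "''[' u , v ]" := (ip H u v).

Lemma ev_sum (I : eqType) (s : seq I) (c : I -> C) (f : I -> H) :
  eq_disc (ev (\sum_(i <- s) c i *: f i)) (fun z => \sum_(i <- s) c i * ev (f i) z).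
Proof.
move=> z dz; elim: s => [|i s IH].
  rewrite !big_nil; have := @ev_linear _ _ H (-1) 0 0 z dz.
  by rewrite scaler0 addr0 => ->; rewrite mulN1r addNr.
by rewrite !big_cons ev_linear// IH.
Qed.

(** The kernel vector at w, chosen for all w so that it can be used in finite
    sums; it is meaningful for w in the disc only. *)
Definition kernel_vec (w : C) : H :=
  xget 0 [set k : H | eq_disc (ev k) (K ^~ w) /\ forall f : H, ev f w = '[f, k]].

Lemma kernel_vecP w : disc w ->
  eq_disc (ev (kernel_vec w)) (K ^~ w) /\
  forall f : H, ev f w = '[f, kernel_vec w].
Proof.
move=> dw; rewrite /kernel_vec; case: xgetP => [k _ //|].
have [k kK kf] := @ev_kernel _ _ H w dw.
by move=> /(_ k) /=; case.
Qed.

Definition kernel_comb (s : seq (C * C)) : H :=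
  \sum_(p <- s) p.1 *: kernel_vec p.2.

Lemma kernel_comb_cat (c : C) s s' :
  kernel_comb ([seq (c * p.1, p.2) | p <- s] ++ s') =
  c *: kernel_comb s + kernel_comb s'.
Proof.
rewrite /kernel_comb big_cat big_map scaler_sumr; congr (_ + _).
by apply: eq_bigr => p _; rewrite scalerA.
Qed.

Lemma dot_kernel_comb s (f : H) : in_disc s ->
  '[kernel_comb s, f] = \sum_(p <- s) p.1 * (ev f p.2)^*.
Proof.
elim: s => [_|p s IH /in_disc_cons[dp ds]].
  by rewrite /kernel_comb !big_nil linear0l.
rewrite /kernel_comb !big_cons linearDl/= linearZl_LR/= IH//; congr (_ * _ + _).
by rewrite (proj2 (kernel_vecP dp)) [LHS]dotC.
Qed.

Lemma normsq_kernel_comb s : in_disc s -> `|kernel_comb s| ^+ 2 = quad K s.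
Proof.
move=> ds; rewrite -ip_norm dotC dot_kernel_comb// rmorph_sum/=.
rewrite /quad exchange_big/= big_seq [RHS]big_seq; apply: eq_bigr => q /ds dq.
rewrite rmorphM/= conjCK (ev_sum _ _ _ dq) mulr_sumr.
rewrite big_seq [RHS]big_seq; apply: eq_bigr => p /ds dp.
by rewrite (kernel_vecP dp).1// mulrCA mulrA.
Qed.

Definition wcomp (g psi : C -> C) (f : C -> C) (z : C) : C := g z * f (psi z).

Definition contracts (Phi : (C -> C) -> C -> C) :=
  forall f : H, exists2 F : H, `|F| <= `|f| & eq_disc (ev F) (Phi (ev f)).

(** The kernel criterion for a weighted composition operator to be a
    contraction.  The positivity hypothesis says exactly that the would-be
    adjoint ([push]) is contractive on combinations of kernel vectors, so that
    for fixed f the functional h |-> <adjoint of h, f> has norm at most |f|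
    there.  The vector representing it is the element of [H] with the required
    values. *)
Theorem wcomp_contracts (g psi : C -> C) :
  (forall z, disc z -> disc (psi z)) ->
  psd (fun z w => K z w - g z * (g w)^* * K (psi z) (psi w)) ->
  contracts (wcomp g psi).
Proof.
move=> dpsi pos f.
pose G (h : H) (l : C) := exists s, [/\ in_disc s, h = kernel_comb s &
  l = '[kernel_comb (push g psi s), f]].
have dpush s : in_disc s -> in_disc (push g psi s) by exact: in_disc_map.
have [] := @riesz_linear_relation _ H (ip H) (@ip_norm _ _ H) G `|f|.
- by exists (kernel_comb [::]), '[kernel_comb [::], f], [::]; split.
- move=> c _ _ _ _ [s [ds -> ->]] [s' [ds' -> ->]].
  exists ([seq (c * p.1, p.2) | p <- s] ++ s'); split.
  + move=> p; rewrite mem_cat => /orP[|/ds'//].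
    by apply: (@in_disc_map _ (fun p => c * p.1) id).
  + by rewrite kernel_comb_cat.
  + rewrite /push map_cat -map_comp.
    have -> : [seq ((c * p.1) * (g p.2)^*, psi p.2) | p <- s] =
       [seq (c * p.1, p.2) | p <- push g psi s].
      by rewrite /push -map_comp; apply: eq_map => p /=; rewrite mulrA.
    by rewrite kernel_comb_cat linearDl/= linearZl_LR.
- by [].
- move=> _ _ [s [ds -> ->]]; apply: le_trans (norm_dot_le (@ip_norm _ _ H) _ _) _.
  rewrite mulrC ler_wpM2l// -(@ler_pXn2r _ 2) ?nnegrE//.
  rewrite !normsq_kernel_comb//; last exact: dpush.
  by rewrite -subr_ge0 quad_push -quadB; exact: pos.
(* The values of F are read off by testing against single kernel vectors. *)
move=> F Ff GF; exists F => // w dw; rewrite /wcomp.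
have {}GF : '[kernel_comb (push g psi [:: (1, w)]), f] = '[kernel_comb [:: (1, w)], F].
  apply: GF; exists [:: (1, w)]; split => // p; by rewrite inE => /eqP->.
have dw1 : in_disc [:: (1 : C, w)] by move=> p; rewrite inE => /eqP->.
move: GF; rewrite !dot_kernel_comb//; last exact: dpush.
rewrite /= !big_seq1 /= !mul1r -rmorphM/= => /(congr1 Num.conj).
by rewrite !conjCK.
Qed.
End WeightedComposition.

(** * Contractions, adjoints and reducing subspaces *)

Section Contractions.
Variables (R : realType) (K : R[i] -> R[i] -> R[i]) (H : rkhs K).
Local Notation C := R[i].
Local Notation "''[' u , v ]" := (ip H u v).

Lemma ev_opp (f : H) : eq_disc (ev (- f)) (fun z => - ev f z).
Proof.
move=> z dz; rewrite -scaleN1r -[_ *: f]addr0 ev_linear// mulN1r.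
rewrite -[RHS]addr0; congr (_ + _).
have := @ev_sum R K H nat [::] (fun=> 0) (fun=> 0) z dz.
by rewrite !big_nil.
Qed.

Section OperatorOf.
Variables (Phi : (C -> C) -> C -> C) (Phi_contracts : contracts H Phi).

Lemma operator_of_acts : acts_as Phi (operator_of Phi : H -> H).
Proof.
move=> f; rewrite /operator_of; case: xgetP => [g _ //|].
by have [F _ FPhi] := Phi_contracts f => /(_ F).
Qed.

Lemma norm_operator_of_le (f : H) : `|operator_of Phi f : H| <= `|f|.
Proof.
have [F Ff FPhi] := Phi_contracts f.
rewrite (_ : operator_of Phi f = F)//; apply: ev_inj => z dz.
by rewrite operator_of_acts// FPhi.
Qed.

Lemma operator_of_linear :
  (forall c u v, eq_disc (Phi (fun z => c * u z + v z))
                         (fun z => c * Phi u z + Phi v z)) ->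
  (forall u v, eq_disc u v -> eq_disc (Phi u) (Phi v)) ->
  linear (operator_of Phi : H -> H).
Proof.
move=> lin ext c f g; apply: ev_inj => z dz.
rewrite ev_linear// !operator_of_acts// -lin//.
by apply: ext => // w dw; exact: ev_linear.
Qed.

End OperatorOf.

Section Linear.
Variable T : H -> H.
Hypotheses (T_lin : linear T) (T_contr : forall f, `|T f| <= `|f|).

Lemma linear_fun0 : T 0 = 0.
Proof. by have := T_lin (-1) 0 0; rewrite scaler0 addr0 scaleN1r addNr. Qed.

Lemma linear_funZ c f : T (c *: f) = c *: T f.
Proof. by rewrite -[c *: f]addr0 T_lin linear_fun0 addr0. Qed.

Lemma linear_funD f g : T (f + g) = T f + T g.
Proof. by rewrite -[f in LHS]scale1r T_lin scale1r. Qed.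

Lemma contraction_continuous : continuous T.
Proof.
move=> x; apply/cvgrPdist_lt => e e0; near=> y.
have -> : T x - T y = T (x - y) by rewrite linear_funD -[- y]scaleN1r linear_funZ scaleN1r.
apply: le_lt_trans (T_contr _) _; near: y.
exact: (@cvgr_dist_lt _ _ _ (nbhs x) _ id x).
Unshelve. all: by end_near. Qed.

Lemma adjoint_exists : exists T', adjoint T T'.
Proof.
have ex g : exists g', forall h, '[T h, g] = '[h, g'].
  have [] := @riesz_linear_relation _ H (ip H) (@ip_norm _ _ H)
    (fun h l => l = '[T h, g]) `|g|.
  - by exists 0, '[T 0, g].
  - by move=> c h h' _ _ -> ->; rewrite T_lin linearDl/= linearZl_LR.
  - by [].
  - move=> h _ ->; apply: le_trans (norm_dot_le (@ip_norm _ _ H) _ _) _.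
    by rewrite mulrC ler_wpM2l.
  by move=> g' _ gg'; exists g' => h; exact: gg'.
exists (fun g => projT1 (cid (ex g))) => f g.
by case: cid => /= g' ->.
Qed.

(** Polarisation with the single coefficient conj d, where d is the difference
    of the two sides: it produces 2 |d|^2 = 0. *)
Lemma isometry_dot : (forall f, `|T f| = `|f|) ->
  forall f g, '[T f, T g] = '[f, g].
Proof.
move=> Tiso f g; apply/eqP; rewrite -subr_eq0; set d := (X in X == 0).
have : `|d^* *: T f + T g| ^+ 2 = `|d^* *: f + g| ^+ 2 by rewrite -T_lin Tiso.
rewrite !(normsq_addZ (@ip_norm _ _ H)) !Tiso => /addIr/addrI/eqP.
rewrite -subr_eq0 => /eqP e.
have : d^* * d + (d^* * d)^* = 0.
  rewrite -[RHS]e {3 6}/d !mulrBr !rmorphB/=.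
  by ring.
rewrite rmorphM/= conjCK (mulrC d^*) -normCK -mulr2n => /eqP.
by rewrite mulrn_eq0/= expf_eq0/= normr_eq0.
Qed.

(** A contractive involution is isometric, since f = T (T f), and therefore its
    adjoint is its inverse, which is itself. *)
Lemma involution_selfadjoint : (forall f, T (T f) = f) -> adjoint T T.
Proof.
move=> TT f g; rewrite -{2}(TT f) isometry_dot// => h.
by apply/le_anti; rewrite T_contr -{1}(TT h) T_contr.
Qed.

End Linear.

Lemma dot_inj (u v : H) : (forall h, '[h, u] = '[h, v]) -> u = v.
Proof.
move=> e; apply/eqP; rewrite -subr_eq0 -normr_eq0 -sqrf_eq0 -ip_norm.
by rewrite linearBr/= e subrr.
Qed.

(** Since [U] is self-adjoint, the adjoint of [T] commutes with [U] as well, and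
    so both preserve its eigenspaces. *)
Theorem commuting_eigenspace_reducing (T U : H -> H) (c : C) :
  linear T -> (forall f, `|T f| <= `|f|) ->
  linear U -> (forall f, `|U f| <= `|f|) -> (forall f, U (U f) = f) ->
  (forall f, T (U f) = U (T f)) ->
  reducing T (op_eigenspace U c).
Proof.
move=> Tlin Tc Ulin Uc UU TU; split.
- split; last 2 first.
  + by rewrite /op_eigenspace /= linear_fun0// scaler0.
  + move=> d f g /= Uf Ug; rewrite /op_eigenspace/= Ulin Uf Ug.
    by rewrite scalerDr !scalerA mulrC.
  + have -> : op_eigenspace U c = (fun f => U f - c *: f) @^-1` [set 0].
      apply/seteqP; split => f; rewrite /op_eigenspace /=.
        by move=> ->; rewrite subrr.
      by move=> /subr0_eq.
    apply: preimage_closed; last first.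
      exact/accessible_closed_set1/hausdorff_accessible/norm_hausdorff.
    move=> f _; apply: cvgB; first exact: contraction_continuous.
    by apply: cvgZ; [exact: cvg_cst|exact: cvg_id].
- by move=> f; rewrite /op_eigenspace/= -TU => ->; rewrite linear_funZ.
- have [T' TT'] := adjoint_exists Tlin Tc; exists T' => //.
  have Usa := involution_selfadjoint Ulin Uc UU.
  move=> f; rewrite /op_eigenspace/= => Uf; apply: dot_inj => h.
  by rewrite -Usa -TT' TU Usa Uf !linearZr_LR/= TT'.
Qed.

End Contractions.

(** * The involution of the disc *)

Section Mobius.
Variables (R : realType).
Local Notation C := R[i].

Lemma derive1_mobius (t a z : C) : `|a| < 1 -> disc z ->
  derive1 (mobius t a : C^o -> C^o) z = t * (1 - a * a^*) / (1 - a^* * z) ^+ 2.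
Proof.
move=> ha dz; have hd := mobius_den ha dz.
have dnum : is_derive (z : C^o) 1 (fun x : C^o => x - a : C^o) 1.
  exact: is_derive_shift.
have dden : is_derive (z : C^o) 1 (fun x : C^o => 1 - a^* * x : C^o) (- a^*).
  rewrite (_ : (fun x : C^o => _) =
    (fun=> 1 : C^o) - (fun=> a^* : C^o) * (fun x : C^o => x)); last by [].
  by apply: is_derive_eq; rewrite sub0r scaler0 addr0 -[X in - X]/(a^* * 1) mulr1.
have dinv : is_derive (z : C^o) 1 (fun x : C^o => (1 - a^* * x)^-1 : C^o)
    (a^* / (1 - a^* * z) ^+ 2).
  apply: DeriveDef; first by apply: derivableV.
  rewrite deriveV// (@derive_val _ _ _ _ _ _ _ dden) scalerN scaleNr opprK.
  by rewrite [LHS]mulrC.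
rewrite derive1E.
have -> : (mobius t a : C^o -> C^o) = (fun x : C^o => t : C^o) *
   ((fun x : C^o => x - a : C^o) * (fun x : C^o => (1 - a^* * x)^-1 : C^o)).
  by [].
rewrite derive_val scaler0 addr0.
rewrite -[LHS]/(t * ((z - a) * (a^* / (1 - a^* * z) ^+ 2) + (1 - a^* * z)^-1 * 1)).
by field.
Qed.

Variables (a : C) (ha : `|a| < 1).
Let phi := mobius (-1) a.
Let d (z : C) := 1 - a^* * z.

Lemma one_sub_conjM_neq0 : 1 - a * a^* != 0 :> C.
Proof. by rewrite -normCK subr_eq0 eq_sym lt_eqF// expr_lt1. Qed.

Lemma involutive_mobius z : disc z -> phi (phi z) = z.
Proof.
move=> dz; have := mobiusK (@normrN1 C) ha dz.
by rewrite rmorphN rmorph1 mulN1r opprK.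
Qed.

Lemma disc_involution z : disc z -> disc (phi z).
Proof. by apply: mobius_disc => //; rewrite normrN1. Qed.

Lemma mobius_factor z : disc z -> d (phi z) = (1 - a * a^*) / d z.
Proof.
move=> dz; have hd := mobius_den ha dz.
by rewrite /d /phi /mobius; field.
Qed.

Lemma one_sub_mobius_conj z w : disc z -> disc w ->
  1 - phi z * (phi w)^* = (1 - a * a^*) * (1 - z * w^*) / (d z * (d w)^*).
Proof.
move=> dz dw; have hz := mobius_den ha dz; have hw := mobius_den ha dw.
have hw' := one_sub_mul_conj_neq0 (ha : disc a) dw.
rewrite /d /phi /mobius rmorphM rmorphN rmorph1 fmorph_div !rmorphB rmorphM rmorph1 /= conjCK.
field.
by rewrite hz hw'.
Qed.

(** The m-th power of the derivative of the involution. *)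
Definition weight (m : nat) (z : C) : C := (- (1 - a * a^*) / d z ^+ 2) ^+ m.

(** The chain rule for phi o phi = id. *)
Lemma mobius_weight_cocycle m z : disc z -> weight m z * weight m (phi z) = 1.
Proof.
move=> dz; have hd := mobius_den ha dz; have h1 := one_sub_conjM_neq0.
rewrite /weight -exprMn mobius_factor// -[RHS](expr1n _ m); congr (_ ^+ m).
rewrite /d; field.
by rewrite h1 hd.
Qed.

(** Invariance of the kernel: each factor 1 - z conj w of the denominator is
    multiplied under the involution by the product of a square root of the
    derivative at z and the conjugate of one at w. *)
Lemma szego_power_mobius m z w : disc z -> disc w ->
  szego_power m.*2 z w =
  weight m z * (weight m w)^* * szego_power m.*2 (phi z) (phi w).
Proof.
move=> dz dw; have hz := mobius_den ha dz; have hw := mobius_den ha dw.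
have hw' := one_sub_mul_conj_neq0 (ha : disc a) dw.
have h1 := one_sub_conjM_neq0.
have hzw := one_sub_mul_conj_neq0 dz dw.
rewrite /szego_power one_sub_mobius_conj// /weight /d.
rewrite rmorphXn fmorph_div rmorphN rmorphXn !rmorphB !rmorphM !rmorph1 /= conjCK.
rewrite (mulrC a^* a) -mul2n !exprM -!exprVn -!exprMn; congr (_ ^+ m).
field.
by rewrite hz hw' hzw h1.
Qed.
End Mobius.

(** * The representation and the Blaschke product on the weighted Bergman space *)

Lemma mulz_contracts (R : realType) (lam : nat) (H : Aspace R lam.+1) :
  contracts H (mul_by id).
Proof.
apply: (@wcomp_contracts _ _ H id id) => // s ds.
rewrite (@eq_quad _ _ (szego_power lam)) ?psd_szego_power// => z w dz dw.
exact: szego_power_step.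
Qed.

Section Bergman.
Variables (R : realType) (a : R[i]) (ha : `|a| < 1) (m : nat).
Local Notation C := R[i].
Variable H : Aspace R m.*2.
Local Notation phi := (mobius (-1) a).
Local Notation psi := (mobius_aut (@normrN1 C) ha).

Lemma wcomp_weight_contracts : contracts H (wcomp (weight a m) phi).
Proof.
apply: wcomp_contracts => [z|s ds]; first exact: disc_involution.
rewrite (@eq_quad _ _ (fun _ _ => 0) _ ds) => [|z w dz dw].
  by rewrite /quad big1// => p _; rewrite big1// => q _; rewrite mulr0.
by rewrite -(szego_power_mobius ha)// subrr.
Qed.

(** The automorphism is an involution, so its inverse, which enters in the
    definition of the action, has the same parameters. *)
Lemma rep_actE (f : C -> C) :
  eq_disc (rep_act m.*2 psi f) (wcomp (weight a m) phi f).
Proof.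
move=> z dz; rewrite /rep_act /rep_inv_act /wcomp /= doubleK.
rewrite (rmorphN1 Num.conj) mulN1r opprK derive1_mobius//; congr (_ ^+ _ * _).
by rewrite mulN1r.
Qed.

Lemma rep_contracts : contracts H (rep_act m.*2 psi).
Proof.
move=> f; have [F Ff FW] := wcomp_weight_contracts f; exists F => // z dz.
by rewrite FW// rep_actE.
Qed.

Local Notation U := (rep psi : H -> H).

Lemma ev_rep (f : H) : eq_disc (ev (U f)) (fun z => weight a m z * ev f (phi z)).
Proof.
move=> z dz.
by rewrite (operator_of_acts rep_contracts)// rep_actE.
Qed.

Lemma rep_involutive (f : H) : U (U f) = f.
Proof.
apply: ev_inj => z dz; have dphi := disc_involution ha dz.
by rewrite !ev_rep// mulrA (mobius_weight_cocycle ha)// mul1r (involutive_mobius ha).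
Qed.

Local Notation B := (fun z : C => z * mobius 1 a z).

Lemma blaschke_mobius z : B z = - (z * phi z).
Proof. by rewrite /mobius mul1r mulN1r mulrN opprK. Qed.

Lemma blaschke_invariant z : disc z -> B (phi z) = B z.
Proof. by move=> dz; rewrite /= !blaschke_mobius (involutive_mobius ha)// mulrC. Qed.

(** Conjugating multiplication by z with [U] gives multiplication by phi, hence
    M_B = - M_z U M_z U, a product of contractions. *)
Lemma mulB_contracts : (0 < m)%N -> contracts H (mul_by B).
Proof.
move=> m0 f; have Zc : contracts H (mul_by id).
  by case: (m) m0 (H) => // k _ H'; exact: mulz_contracts.
have Uc := norm_operator_of_le rep_contracts.
have [F1 F1f F1E] := Zc (U f); have [F2 F2f F2E] := Zc (U F1).
exists (- F2).
  rewrite normrN (le_trans F2f)// (le_trans (Uc _))// (le_trans F1f)//.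
  exact: Uc.
move=> z dz; have dphi := disc_involution ha dz.
rewrite ev_opp// F2E// /mul_by ev_rep// F1E// /mul_by ev_rep//.
rewrite (involutive_mobius ha)// blaschke_mobius mulNr; congr (- _).
by rewrite [weight a m z * _]mulrCA [_ * (_ * ev f z)]mulrA (mobius_weight_cocycle ha)// mul1r mulrA.
Qed.

Lemma wcomp_linear (g p : C -> C) c u v :
  eq_disc (wcomp g p (fun z => c * u z + v z))
          (fun z => c * wcomp g p u z + wcomp g p v z).
Proof. by move=> z _; rewrite /wcomp mulrDr mulrCA. Qed.

Lemma rep_linear : linear U.
Proof.
apply: (operator_of_linear rep_contracts) => [c u v|u v uv] z dz.
  by rewrite !rep_actE// wcomp_linear.
by rewrite !rep_actE// /wcomp uv//; exact: disc_involution.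
Qed.

Lemma mulB_linear : (0 < m)%N -> linear (mul_op B : H -> H).
Proof.
move=> m0; apply: (operator_of_linear (mulB_contracts m0)) => [c u v|u v uv] z dz.
  by rewrite /mul_by mulrDr mulrCA.
by rewrite /mul_by uv.
Qed.

Lemma mulB_rep_comm : (0 < m)%N -> forall f : H, mul_op B (U f) = U (mul_op B f).
Proof.
move=> m0 f; apply: ev_inj => z dz; have dphi := disc_involution ha dz.
have MB := operator_of_acts (mulB_contracts m0).
by rewrite MB// /mul_by !ev_rep// MB// /mul_by blaschke_invariant// mulrCA.
Qed.
End Bergman.

Theorem theorem7p6 (R : realType) (a : R[i]) (ha : `|a| < 1)
    (lam : nat) (lam_gt0 : (0 < lam)%N) (lam_even : ~~ odd lam)
    (H : Aspace R lam) :
  let B := fun z : R[i] => z * mobius 1 a z in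
  let psi := mobius_aut (@normrN1 R[i]) ha in
  let M_B : H -> H := mul_op B in
  let U : H -> H := @rep R lam H psi in
  let P1 : H -> H := half_sum U in
  [/\ bounded_operator M_B /\ acts_as (mul_by B) M_B,
      bounded_operator U /\ acts_as (rep_act lam psi) U,
      forall f : H, M_B (P1 f) = P1 (M_B f),
      reducing M_B (op_eigenspace U 1) &
      reducing M_B (op_eigenspace U (-1))].
Proof.
have [m lamE] : exists m, lam = m.*2.
  by exists lam./2; rewrite -[LHS]odd_double_half (negPf lam_even).
subst lam; move=> B psi M_B U P1.
have m0 : (0 < m)%N by rewrite -double_gt0.
have Bc := mulB_contracts ha (H := H) m0; have Uc := rep_contracts ha (H := H).
have Blin := mulB_linear ha (H := H) m0; have Ulin := rep_linear ha (H := H).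
have Bn := norm_operator_of_le Bc; have Un := norm_operator_of_le Uc.
have BU := mulB_rep_comm ha (H := H) m0; have UU := rep_involutive ha (H := H).
split.
- split; [split|]; [exact: Blin|exact: contraction_continuous|].
  exact: operator_of_acts.
- split; [split|]; [exact: Ulin|exact: contraction_continuous|].
  exact: operator_of_acts.
- by move=> f; rewrite /P1 /half_sum /M_B /U (linear_funZ Blin) (linear_funD Blin) BU.
- exact: commuting_eigenspace_reducing.
- exact: commuting_eigenspace_reducing.
Qed.
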